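(* Consider an instance of the Oven Scheduling Problem (OSP). Then the total number $b$ of batches in any feasible solution satisfies $$b\ \ge\ \sum_{r=1}^{a}\bigl(|J_r^l|+\max(b_r^E,b_r^C)\bigr),$$ where for each attribute $r\in\mathcal{A}=\{1,\dots,a\}$, the set $J_r^l$ of large jobs and the quantities $b_r^E$ and $b_r^C$ are as defined in the context.
   Context: OSP instance. A finite set $\mathcal{M}=\{1,\dots,k\}$ of machines, a finite set $\mathcal{J}=\{1,\dots,n\}$ of jobs, a set $\mathcal{A}=\{1,\dots,a\}$ of attributes, and a scheduling horizon length $l\in\mathbb{N}$. Each machine $m$ has a capacity $c_m$ (a positive integer), an initial state $s_m\in\mathcal{A}$, and $I$ availability intervals $[as(m,i),ae(m,i)]\subseteq[0,l]$, $1\le i\le I$, with $as(m,i)\le ae(m,i)\le as(m,i+1)$. Each job $j$ has a set $\mathcal{E}_j\subseteq\mathcal{M}$ of eligible machines, an earliest start time $et_j\in\mathbb{N}$ with $0\le et_j<l$, a latest end time $lt_j\in\mathbb{N}$ with $et_j<lt_j\le l$, natural numbers $0<mint_j\le maxt_j$ (minimal and maximal processing time), a size $s_j\in\mathbb{N}$, and an attribute $a_j\in\mathcal{A}$. There are $a\times a$ matrices of non-negative integer setup times $st(\cdot,\cdot)$ and setup costs $sc(\cdot,\cdot)$, indexed by ordered pairs of attributes (not necessarily symmetric). Feasible solution. Jobs are partitioned into non-empty batches; each batch is assigned to a machine, and the batches on machine $m$ are ordered $B_{m,1},\dots,B_{m,b_m}$ ($b_m$ is the number of batches on $m$). Each batch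 $B_{m,b}$ has an integer start time $S_{m,b}\in[0,l]$, and its processing time is $P_{m,b}=\max_{j\in B_{m,b}} mint_j$. For every batch $B_{m,b}$ and all $j\in B_{m,b}$: $m\in\mathcal{E}_j$; $S_{m,b}\ge et_j$; $P_{m,b}\le maxt_j$. All jobs in a batch have the same attribute, which is the attribute $A_{m,b}$ of the batch. The total size satisfies $\sum_{j\in B_{m,b}}s_j\le c_m$. Consecutive batches satisfy $S_{m,b}+P_{m,b}+st(A_{m,b},A_{m,b+1})\le S_{m,b+1}$. Each batch together with its preceding setup lies within one availability interval: for each $m,b$ there is $i$ with $S_{m,b}+P_{m,b}\le ae(m,i)$ and $as(m,i)\le S_{m,b}-st(A',A_{m,b})$, where $A'=A_{m,b-1}$ if $b\ge2$ and $A'=s_m$ if $b=1$. (Due dates $lt_j$ need not be met.) Large and small jobs. $J_r^l=\{j\in\mathcal{J}: a_j=r \text{ and } \max_{m\in\mathcal{E}_j}c_m - s_j<\min_{i\in\mathcal{J}:a_i=r}s_i\}$, and $J_r^s=\{j\in\mathcal{J}:a_j=r\}\setminus J_r^l$. Quantity $b_r^E$ (machine eligibility). For $i\in\mathcal{M}$ let $b_{r,i}=\frac{1}{c_i}\sum_{j\in J_r^s:\ \mathcal{E}_j=\{i\}}s_j$ and $cap_i=(\lceil b_{r,i}\rceil-b_{r,i})\cdot c_i$. Let $S_r=\sum_{j\in J_r^s:\ |\mathcal{E}_j|>1}s_j$. Then $$b_r^E=\sum_{i\in\mathcal{M}}\lceil b_{r,i}\rceil+\left\lceil\frac{\max\bigl(0,\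 S_r-\sum_{i\in\mathcal{M}}cap_i\bigr)}{\max_{m\in\mathcal{M}}c_m}\right\rceil .$$ Quantity $b_r^C$ (compatible processing times). $b_r^C=GACb(J_r^s,\max_{m\in\mathcal{M}}c_m)$, where for a set $J$ of jobs, $GACb(J,c)$ is the number of batches returned by the following Algorithm GAC+ when every job $j\in J$ is replaced by $s_j$ identical unit size copies (with the same $mint_j$, $maxt_j$). Algorithm GAC+: consider the unit size jobs in non-increasing order of $mint_j$, ties broken arbitrarily. Repeatedly, until all jobs are placed, open a new batch, let $j^*$ be the first job in this order not yet placed, and, starting with $j^*$, place into the batch the first $c$ not yet placed jobs $j$ with $mint_{j^*}\in[mint_j,maxt_j]$ (or all of them if there are fewer than $c$). The number of batches does not depend on how ties are broken. *)

(* Defs.v *)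
From HB Require Import structures.
From mathcomp Require Import all_boot all_order all_algebra.

Set Implicit Arguments.
Unset Strict Implicit.
Unset Printing Implicit Defensive.

(* Machines, jobs, attributes and availability intervals are numbered from 0
   (types 'I_k, 'I_n, 'I_a, 'I_n_avail). All times are natural numbers. *)
Record osp_instance (k n a : nat) := OspInstance {
  horizon : nat;
  capacity : 'I_k -> nat;
  init_state : 'I_k -> 'I_a;
  n_avail : nat;
  avail_start : 'I_k -> 'I_n_avail -> nat;
  avail_end : 'I_k -> 'I_n_avail -> nat;
  elig : 'I_n -> {set 'I_k};
  earliest : 'I_n -> nat;
  latest : 'I_n -> nat;
  mint : 'I_n -> nat;
  maxt : 'I_n -> nat;
  jsize : 'I_n -> nat;
  attr : 'I_n -> 'I_a;
  setup_time : 'M[nat]_a;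
  setup_cost : 'M[nat]_a;
  capacity_gt0 : forall m, 0 < capacity m;
  avail_start_le_end : forall m i, avail_start m i <= avail_end m i;
  avail_end_le_next : forall m (i i' : 'I_n_avail),
    i' = i.+1 :> nat -> avail_end m i <= avail_start m i';
  avail_end_le_horizon : forall m i, avail_end m i <= horizon;
  earliest_lt_horizon : forall j, earliest j < horizon;
  earliest_lt_latest : forall j, earliest j < latest j;
  latest_le_horizon : forall j, latest j <= horizon;
  mint_gt0 : forall j, 0 < mint j;
  mint_le_maxt : forall j, mint j <= maxt j
}.

Arguments avail_start {k n a} _ _ _.
Arguments avail_end {k n a} _ _ _.

(* The batches on machine m are those at positions b < n_batches m, counted
   from 0; the values at other positions are irrelevant. *)
Record osp_solution (k n a : nat) := OspSolution {
  n_batches : 'I_k -> nat;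
  batch : 'I_k -> nat -> {set 'I_n};
  start : 'I_k -> nat -> nat;
  battr : 'I_k -> nat -> 'I_a
}.

Definition total_batches (k n a : nat) (sol : osp_solution k n a) : nat :=
  \sum_(m < k) n_batches sol m.

Section Feasibility.

Variables (k n a : nat) (I : osp_instance k n a) (sol : osp_solution k n a).

Definition proc_time (m : 'I_k) (b : nat) : nat :=
  \max_(j in batch sol m b) mint I j.

Definition prev_attr (m : 'I_k) (b : nat) : 'I_a :=
  if b is b'.+1 then battr sol m b' else init_state I m.

Record feasible : Prop := Feasible {
  batches_nonempty : forall m b, b < n_batches sol m ->
    batch sol m b != set0;
  batches_partition : forall j : 'I_n, exists! p : 'I_k * nat,
    p.2 < n_batches sol p.1 /\ j \in batch sol p.1 p.2;
  start_le_horizon : forall m b, b < n_batches sol m ->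
    start sol m b <= horizon I;
  batch_elig : forall m b, b < n_batches sol m ->
    forall j, j \in batch sol m b -> m \in elig I j;
  batch_earliest : forall m b, b < n_batches sol m ->
    forall j, j \in batch sol m b -> earliest I j <= start sol m b;
  batch_maxt : forall m b, b < n_batches sol m ->
    forall j, j \in batch sol m b -> proc_time m b <= maxt I j;
  batch_attr : forall m b, b < n_batches sol m ->
    forall j, j \in batch sol m b -> attr I j = battr sol m b;
  batch_size : forall m b, b < n_batches sol m ->
    \sum_(j in batch sol m b) jsize I j <= capacity I m;
  batch_consecutive : forall m b, b.+1 < n_batches sol m ->
    start sol m b + proc_time m b
      + setup_time I (battr sol m b) (battr sol m b.+1)
      <= start sol m b.+1;
  (* The setup time is moved to the left-hand side, since subtraction on nat
     is truncated. *)
  batch_available : forall m b, b < n_batches sol m ->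
    exists i : 'I_(n_avail I),
      start sol m b + proc_time m b <= avail_end I m i /\
      avail_start I m i + setup_time I (prev_attr m b) (battr sol m b)
        <= start sol m b
}.

End Feasibility.

Section Bounds.

Variables (k n a : nat) (I : osp_instance k n a).

(* The minimum is over a set containing j, so the default value jsize I j does
   not affect it; jsize I j is moved to the right-hand side, since subtraction
   on nat is truncated. *)
Definition large_jobs (r : 'I_a) : {set 'I_n} :=
  [set j | (attr I j == r) &&
    (\max_(m in elig I j) capacity I m
       < jsize I j + \big[minn/jsize I j]_(i | attr I i == r) jsize I i)].

Definition small_jobs (r : 'I_a) : {set 'I_n} :=
  [set j | attr I j == r] :\: large_jobs r.

Definition max_capacity : nat := \max_(m < k) capacity I m.

Section Eligibility.

Import GRing.Theory Num.Theory.
Local Open Scope ring_scope.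

Definition bE_machine (r : 'I_a) (i : 'I_k) : rat :=
  (capacity I i)%:R^-1 *
  (\sum_(j in small_jobs r | elig I j == [set i]) jsize I j)%N%:R.

Definition bE_cap (r : 'I_a) (i : 'I_k) : rat :=
  ((Num.ceil (bE_machine r i))%:~R - bE_machine r i) * (capacity I i)%:R.

Definition bE_flex_size (r : 'I_a) : nat :=
  (\sum_(j in small_jobs r | 1 < #|elig I j|) jsize I j)%N.

Definition bE (r : 'I_a) : int :=
  \sum_(i < k) Num.ceil (bE_machine r i) +
  Num.ceil (Num.max 0 ((bE_flex_size r)%:R - \sum_(i < k) bE_cap r i)
            / max_capacity%:R).

End Eligibility.

(* A unit size copy of a job is represented by the job itself, so a job j
   occurs jsize I j times. *)
Definition unit_copies (J : {set 'I_n}) : seq 'I_n :=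
  flatten [seq nseq (jsize I j) j | j <- enum J].

(* The orders in which GAC+ may consider the unit size copies, over all ways
   of breaking ties. *)
Definition gac_order (J : {set 'I_n}) (s : seq 'I_n) : bool :=
  perm_eq s (unit_copies J) && sorted (fun j j' => mint I j' <= mint I j) s.

(* The first c jobs j of s with t in [mint j, maxt j] (all of them if there are
   fewer), paired with the remaining jobs of s in the same order. *)
Fixpoint gac_fill (t c : nat) (s : seq 'I_n) : seq 'I_n * seq 'I_n :=
  if s is j :: s' then
    if (0 < c) && (mint I j <= t <= maxt I j) then
      let: (B, rest) := gac_fill t c.-1 s' in (j :: B, rest)
    else
      let: (B, rest) := gac_fill t c s' in (B, j :: rest)
  else ([::], [::]).

(* For c > 0 every batch contains at least the first job of s, so size s
   rounds suffice to place all jobs. *)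
Fixpoint gac_rec (fuel c : nat) (s : seq 'I_n) : seq (seq 'I_n) :=
  if fuel is fuel'.+1 then
    if s is j :: _ then
      let: (B, rest) := gac_fill (mint I j) c s in B :: gac_rec fuel' c rest
    else [::]
  else [::].

Definition gac (c : nat) (s : seq 'I_n) : seq (seq 'I_n) :=
  gac_rec (size s) c s.

(* GACb(J, c), computed with the order s of the unit size copies of J. *)
Definition GACb (c : nat) (s : seq 'I_n) : nat := size (gac c s).

Definition bC (s : seq 'I_n) : nat := GACb max_capacity s.

End Bounds.

(* Main.v *)
Require Import Defs.
From mathcomp Require Import all_boot all_order all_algebra.
From mathcomp Require Import zify.

Set Implicit Arguments.
Unset Strict Implicit.
Unset Printing Implicit Defensive.

(** A batch of attribute r that contains a large job contains no other job, so
    the batches of attribute r with a large job number at least the large jobs,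
    and it remains to bound the number of batches made of small jobs only.

    Eligibility: if machine i has x_i such batches, then x_i >= ceil b_{r,i};
    the other jobs fit in the total slack of the first ceil b_{r,i} batches of
    each machine and in the sum of (x_i - ceil b_{r,i}) further batches, each
    of at most the maximal capacity.

    GAC+: a set of jobs can share a batch iff the intervals [mint j, maxt j]
    have a common point. All unplaced jobs start at or before t = mint j*, so
    among those that contain t the ones with larger mint are the harder to
    place elsewhere; hence by exchange some optimal solution uses the batch of GAC+. *)

Import Order.TTheory GRing.Theory Num.Theory.

(** * Counting with multiplicities in sequences *)

Lemma count_sum_mem (T : eqType) (r s : seq T) (A : pred T) :
    uniq r -> {subset s <= r} ->
  count A s = \sum_(x <- r | A x) count_mem x s.
Proof.
move=> Ur; elim: s => [|y s IHs] sr /=; first by rewrite big1.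
rewrite big_split /= -IHs; last by move=> x xs; apply: sr; rewrite inE xs orbT.
congr (_ + _).
have yr : y \in r by apply: sr; rewrite inE eqxx.
rewrite (eq_bigr (fun x => nat_of_bool (y == x))) // -big_mkcondr sum1_count.
rewrite (eq_count (a2 := [pred x | (x == y) && A y])); last first.
  by move=> x /=; rewrite eq_sym; case: eqP => [->|]; rewrite ?andbT ?andbF.
case Ay: (A y); last first.
  by rewrite (eq_count (a2 := pred0)) ?count_pred0 // => x /=; rewrite andbF.
rewrite (eq_count (a2 := pred1 y)) ?count_uniq_mem ?yr // => x /=.
by rewrite andbT.
Qed.

(** Needed when [minn t] merges several points into one: the multiplicity of a merged point counts a
    whole preimage. *)
Lemma leq_count_mem (T : eqType) (c : nat) (s1 s2 : seq T) :
    (forall x, count_mem x s1 <= c * count_mem x s2) ->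
  forall A : pred T, count A s1 <= c * count A s2.
Proof.
move=> le_s12 A.
rewrite !(@count_sum_mem _ (undup (s1 ++ s2))) ?undup_uniq //.
- by rewrite big_distrr /= leq_sum.
- by move=> x; rewrite mem_undup mem_cat => ->; rewrite orbT.
- by move=> x; rewrite mem_undup mem_cat => ->.
Qed.

(** * Optimality of GAC+ by exchange *)

Section GreedyBound.

Variables (k n a : nat) (I : osp_instance k n a).

Local Notation fits := (fun j p => mint I j <= p <= maxt I j).
Local Notation mint_ge := (fun j j' => mint I j' <= mint I j).

Lemma mint_ge_trans : transitive mint_ge.
Proof. by move=> y x z xy yz; apply: leq_trans yz xy. Qed.

Lemma gac_fill_subseq t c s : subseq (gac_fill I t c s).2 s.
Proof.
elim: s c => [|x s IHs] c //=; case: ifP => _.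
  case: gac_fill (IHs c.-1) => B rest /= sub_rest.
  exact: subseq_trans sub_rest (subseq_cons s x).
by case: gac_fill (IHs c) => B rest /=; rewrite eqxx.
Qed.

(** The exchange: the first job served at [t], if any, moves down to [p]. It still fits, since its
    minimal time is at most [p] and its maximal time at least [t > p]. *)
Lemma move_point p t s q :
    all (fun j => mint I j <= p) s -> p < t -> all2 fits s q ->
  exists q', [/\ all2 fits s q', count_mem t q' <= (count_mem t q).-1
    & forall u, u != t -> count_mem u q' <= count_mem u q + (u == p)].
Proof.
move=> ms pt; elim: s ms q => [|x s IHs] /= => [_|/andP[xp ms]] [|v q] //=.
  by exists [::].
move=> /andP[xv sq]; have [vt|vt] := eqVneq v t.
  exists (p :: q); split=> /=; first by rewrite sq; lia.
    by rewrite ltn_eqF.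
  by move=> u ut; rewrite [u == p]eq_sym; lia.
have [q' [sq' tq' uq']] := IHs ms q sq.
exists (v :: q'); split=> [|| u ut] /=; rewrite ?xv ?(negPf vt) //.
by rewrite -addnA leq_add2l uq'.
Qed.

(** Each job put into the GAC+ batch frees one place at [t], if one is still occupied: its own, or
    that of a job which takes over its earlier point. *)
Lemma gac_fill_points t c s q :
    sorted mint_ge s -> all (fun j => mint I j <= t) s ->
    all2 fits s q -> all (fun p => p <= t) q ->
  exists q', [/\ all2 fits (gac_fill I t c s).2 q',
    count_mem t q' <= count_mem t q - c
    & forall u, u != t -> count_mem u q' <= count_mem u q].
Proof.
elim: s c q => [|x s IHs] c [|p q] //=; first by exists [::].
rewrite (path_sortedE mint_ge_trans) => /andP[xs ss] /andP[xt st].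
move=> /andP[xp sq] /andP[pt qt]; case: ifP => [/andP[c_gt0 xtt]|xNfill].
  have [q1 []] := IHs c.-1 q ss st sq qt.
  have := gac_fill_subseq t c.-1 s.
  case: gac_fill => B rest /= rest_s restq1 tq1 uq1.
  have [pEt|p_neq_t] := eqVneq p t.
    by exists q1; split=> // [|u ut]; rewrite ?(leq_trans (uq1 u ut)); lia.
  (* The job x leaves its point p < t to some remaining job that is served at
     t: that job also fits p, as its minimal time is at most that of x. *)
  have rest_p : all (fun j => mint I j <= p) rest.
    apply/allP => j /(mem_subseq rest_s) js.
    by apply: leq_trans (allP xs j js) _; case/andP: xp.
  have p_lt_t : p < t by rewrite ltn_neqAle p_neq_t.
  have [q' [restq' tq' uq']] := move_point rest_p p_lt_t restq1.
  exists q'; split=> // [|u ut].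
    rewrite add0n (leq_trans tq') // -(prednK c_gt0) subnS.
    by rewrite -[leqLHS]subn1 -[leqRHS]subn1 leq_sub2r.
  by rewrite (leq_trans (uq' u ut)) // addnC [u == p]eq_sym leq_add2l uq1.
have [q1 []] := IHs c q ss st sq qt.
case: gac_fill => B rest /= restq1 tq1 uq1.
exists (p :: q1); split=> /= [||u ut]; first by rewrite xp.
  (* If the batch still has room, [x] was skipped because it does not fit [t], so its point [p] is
     not [t]. *)
  case: c {IHs} xNfill tq1 => [|c] /= xNfill tq1; first by lia.
  have /negPf-> : p != t by apply/eqP => ptE; rewrite -ptE xp in xNfill.
  by [].
by rewrite leq_add2l uq1.
Qed.

Lemma gac_rec_cons fuel c j s :
  gac_rec I fuel.+1 c (j :: s) =
    (gac_fill I (mint I j) c (j :: s)).1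
      :: gac_rec I fuel c (gac_fill I (mint I j) c (j :: s)).2.
Proof. by rewrite /=; case: ifP => _; case: gac_fill. Qed.

(* A partition of s into batches of at most c jobs is recorded by the points P
   of the batches and the list q of the points at which the jobs are served:
   which of several batches with the same point serves a job is irrelevant. *)
Lemma gac_rec_points fuel c s q (P : seq nat) :
    sorted mint_ge s -> all2 fits s q ->
    (forall p, count_mem p q <= c * count_mem p P) ->
  size (gac_rec I fuel c s) <= size P.
Proof.
elim: fuel s q P => [|fuel IHf] // [|j s] // [|p q] // P ss sq qP.
rewrite gac_rec_cons; set t := mint I j; have := ss.
rewrite [sorted _ _]/= (path_sortedE mint_ge_trans).
case/andP=> js _; have st : all (fun i => mint I i <= t) (j :: s).
  by rewrite /= leqnn.
(* No remaining job has minimal time above [t], so lowering the points beyond [t] to [t] keeps every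
   job served. The first job, whose minimal time is [t], is then served exactly at [t], so [P1]
   contains [t]. *)
pose q1 := map (minn t) (p :: q); pose P1 := map (minn t) P.
have sq1 : all2 fits (j :: s) q1.
  rewrite /q1; elim: (j :: s) (p :: q) st sq => [|i s' IH] [|v q'] //=.
  by move=> /andP[it ?] /andP[iv ?]; rewrite IH // andbT /=; lia.
have q1P1 u : count_mem u q1 <= c * count_mem u P1.
  by rewrite !count_map leq_count_mem.
have q1t : all (fun u => u <= t) q1.
  by apply/allP => _ /mapP[u _ ->]; rewrite geq_minl.
have [q' [restq' tq' uq']] := gac_fill_points c ss st sq1 q1t.
have tP1 : t \in P1.
  have tp : minn t p = t by apply/minn_idPl; case/andP: sq => /andP[].
  rewrite -has_pred1 has_count; have := q1P1 t.
  by rewrite /q1 /= tp eqxx; case: (count_mem t P1); rewrite ?muln0.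
have P1E := perm_to_rem tP1;
rewrite -(size_map (minn t) P) -/P1 (perm_size P1E) /= ltnS.
apply: IHf restq' _ => [|u].
  by apply: subseq_sorted (gac_fill_subseq t c _) ss; apply: mint_ge_trans.
have := q1P1 u; rewrite (permP P1E) /= mulnDr; have [->|ut] := eqVneq u t.
  by rewrite muln1 -leq_subLR => /(leq_trans tq').
by rewrite muln0; apply: leq_trans (uq' u ut).
Qed.

Lemma count_unit_copies (J : {set 'I_n}) (A : pred 'I_n) :
  count A (unit_copies I J) = \sum_(j in J | A j) jsize I j.
Proof.
rewrite count_flatten -map_comp sumnE big_map big_enum_cond [RHS]big_mkcondr /=.
apply: eq_big => j; first by rewrite andbT.
by rewrite count_nseq; case: (A j); rewrite ?mul1n.
Qed.

(** All copies of a job are served at the point of its batch. Distinct batches may share a point,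
    hence the sum over the batches with point [p]. *)
Lemma GACb_le (T : finType) (B : {set T}) (c : nat) (point : T -> nat)
    (J : {set 'I_n}) (loc : 'I_n -> T) (s : seq 'I_n) :
    gac_order I J s ->
    {in J, forall j, loc j \in B} ->
    {in J, forall j, mint I j <= point (loc j) <= maxt I j} ->
    {in B, forall t, \sum_(j in J | loc j == t) jsize I j <= c} ->
  GACb I c s <= #|B|.
Proof.
move=> /andP[sE ss] JB Jfits Bc.
have -> : #|B| = size [seq point t | t <- enum B] by rewrite size_map -cardE.
apply: (@gac_rec_points _ _ _ [seq point (loc j) | j <- s]) => //.
  rewrite all2E size_map eqxx /= -[X in zip X _]map_id zip_map all_map.
  apply/allP => j; rewrite (perm_mem sE) => /flatten_mapP[i iJ].
  by rewrite mem_nseq => /andP[_ /eqP->]; apply: Jfits; rewrite -mem_enum.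
move=> p; rewrite !count_map (permP sE) count_unit_copies.
rewrite -sum1_count big_enum_cond /= big_distrr /=.
rewrite (partition_big loc (fun t => (t \in B) && (point t == p))) => [|j] /=.
  apply: leq_sum => t /andP[tB _]; rewrite muln1; apply: leq_trans (Bc t tB).
  rewrite big_mkcond [leqRHS]big_mkcond leq_sum // => j _.
  by case: ifP => // /andP[/andP[-> _] ->].
by case/andP=> jJ ->; rewrite JB.
Qed.

End GreedyBound.

(** * The machine eligibility bound *)

Section EligibilityBound.

Variables (k n a : nat) (I : osp_instance k n a) (r : 'I_a).
Variables (T : finType) (B : {set T}) (mach : T -> 'I_k) (loc : 'I_n -> T).

Local Notation J := (small_jobs I r).

Hypothesis locB : {in J, forall j, loc j \in B}.
Hypothesis loc_elig : {in J, forall j, mach (loc j) \in elig I j}.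
Hypothesis loc_size :
  {in B, forall t, \sum_(j in J | loc j == t) jsize I j <= capacity I (mach t)}.

Let nB (i : 'I_k) : nat := #|[set t in B | mach t == i]|.
(** This is $c_i b_{r,i}$, kept in [nat] for the counting arguments. *)
Let dedicated (i : 'I_k) : nat := \sum_(j in J | elig I j == [set i]) jsize I j.

Lemma size_on_machine i :
  \sum_(j in J | mach (loc j) == i) jsize I j <= nB i * capacity I i.
Proof.
rewrite (partition_big loc [in [set t in B | mach t == i]]) => [|j] /=.
  rewrite /nB -sum_nat_const; apply: leq_sum => t.
  rewrite inE => /andP[tB /eqP <-].
  apply: leq_trans (loc_size tB).
  rewrite big_mkcond [leqRHS]big_mkcond leq_sum // => j _.
  by case: ifP => // /andP[/andP[-> _] ->].
by case/andP=> jJ ji; rewrite inE locB.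
Qed.

Lemma dedicated_le i : dedicated i <= nB i * capacity I i.
Proof.
apply: leq_trans (size_on_machine i); rewrite /dedicated.
rewrite big_mkcond [leqRHS]big_mkcond leq_sum // => j _.
case: ifP => // /andP[jJ /eqP eji].
by have := loc_elig jJ; rewrite jJ eji inE => ->.
Qed.

(** Flexible jobs and jobs dedicated to the various machines form disjoint classes of small jobs,
    all held by the batches in [B]. *)
Lemma flex_size_le :
  bE_flex_size I r + \sum_i dedicated i <= \sum_i nB i * capacity I i.
Proof.
apply: leq_trans (_ : \sum_(j in J) jsize I j <= _); last first.
  rewrite (partition_big (mach \o loc) xpredT) //=.
  by apply: leq_sum => i _; apply: size_on_machine.
rewrite (bigID (fun j => 1 < #|elig I j|)) /= leq_add2l.
rewrite [leqRHS](partition_big (mach \o loc) xpredT) //=.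
apply: leq_sum => i _; rewrite /dedicated.
rewrite big_mkcond [leqRHS]big_mkcond leq_sum // => j _.
case: ifP => // /andP[jJ /eqP eji].
by have := loc_elig jJ; rewrite jJ eji cards1 inE => ->.
Qed.

Lemma card_machines : #|B| = \sum_i nB i.
Proof.
rewrite -sum1_card (partition_big mach xpredT) //=.
apply: eq_bigr => i _; rewrite /nB -sum1_card.
by apply: eq_bigl => t; rewrite inE.
Qed.

Local Open Scope ring_scope.

Lemma bE_le : bE I r <= #|B|%:Z.
Proof.
pose z i := Num.ceil (bE_machine I r i).
have c_gt0 i : 0 < (capacity I i)%:R :> rat by rewrite ltr0n capacity_gt0.
have z_le i : z i <= (nB i)%:Z.
  rewrite ceil_le_int /bE_machine mulrC ler_pdivrMr // -pmulrn -natrM ler_nat.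
  exact: dedicated_le.
have capE i : bE_cap I r i = (z i)%:~R * (capacity I i)%:R - (dedicated i)%:R.
  by rewrite /bE_cap mulrBl /bE_machine mulrAC mulVf ?mul1r ?gt_eqF.
have -> : #|B|%:Z = \sum_i z i + \sum_i ((nB i)%:Z - z i).
  rewrite -big_split card_machines -natz natr_sum.
  by apply: eq_bigr => i _ /=; rewrite natz addrC subrK.
rewrite lerD2l ceil_le_int.
have Y_ge0 : 0 <= (\sum_i ((nB i)%:Z - z i))%:~R :> rat.
  by rewrite ler0z sumr_ge0 // => i _; rewrite subr_ge0.
(* Capacities are positive, so this is the case without machines; the quotient by zero is 0. *)
have [->|M_neq0] := eqVneq (max_capacity I) 0%N; first by rewrite invr0 mulr0.
have M_gt0 : 0 < (max_capacity I)%:R :> rat by rewrite ltr0n lt0n.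
rewrite ler_pdivrMr // ge_max (mulr_ge0 Y_ge0 (ltW M_gt0)) /=.
(* Moving the slack across leaves flexible plus dedicated size on the left; termwise, the
   [nB i - z i] surplus batches of machine [i] hold at most the maximal capacity each. *)
rewrite (eq_bigr _ (fun i _ => capE i)) sumrB opprB addrA lerBlDr.
move: (bE_flex_size I r) flex_size_le => F.
rewrite -(ler_nat rat) natrD !natr_sum => /le_trans -> //.
rewrite rmorph_sum /= mulr_suml -big_split /=; apply: ler_sum => i _.
rewrite natrM -lerBlDr -mulrBl rmorphB /= -pmulrn ler_wpM2l //.
  by rewrite subr_ge0 -[leRHS]/((nB i)%:Z%:~R) ler_int.
by rewrite ler_nat leq_bigmax.
Qed.

End EligibilityBound.

(** * Large and small batches of a feasible solution *)

Section Batches.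

Variables (k n a : nat) (I : osp_instance k n a) (sol : osp_solution k n a).
Hypothesis feas : feasible I sol.

Definition batch_id := {m : 'I_k & 'I_(n_batches sol m)}.

Definition jobs (t : batch_id) : {set 'I_n} := batch sol (tag t) (tagged t).

Definition large_batches (r : 'I_a) : {set batch_id} :=
  [set t | [exists j in large_jobs I r, j \in jobs t]].

Definition small_batches (r : 'I_a) : {set batch_id} :=
  [set t | [exists j in small_jobs I r, j \in jobs t]].

Lemma card_batch_id : #|{: batch_id}| = total_batches sol.
Proof.
rewrite card_tagged sumnE big_map big_enum.
by apply: eq_bigr => m _; rewrite card_ord.
Qed.

Lemma batch_index : exists loc : 'I_n -> batch_id,
  forall j t, (j \in jobs t) = (loc j == t).
Proof.
suff: forall j, exists u : batch_id, forall t, (j \in jobs t) = (u == t).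
  by case/fin_all_exists => loc locE; exists loc.
move=> j; have [[m b] [[/= bm jb] uniq_mb]] := batches_partition feas j.
exists (existT _ m (Ordinal bm)) => -[m' b']; apply/idP/eqP => [jb'|<- //].
have [] := uniq_mb (m', val b') (conj (ltn_ord b') jb').
move=> mE bE; subst m'; congr existT; exact: val_inj.
Qed.

Lemma jobs_attr t :
  {in jobs t, forall j, attr I j = battr sol (tag t) (tagged t)}.
Proof. exact: (batch_attr feas (ltn_ord (tagged t))). Qed.

Lemma jobs_elig t : {in jobs t, forall j, tag t \in elig I j}.
Proof. exact: (batch_elig feas (ltn_ord (tagged t))). Qed.

Lemma jobs_size t : \sum_(j in jobs t) jsize I j <= capacity I (tag t).
Proof. exact: (batch_size feas (ltn_ord (tagged t))). Qed.

(** The processing time, being the maximum of the minimal times, is a common point of the intervals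
    of the batch. *)
Lemma jobs_fit t : {in jobs t, forall j,
  mint I j <= proc_time I sol (tag t) (tagged t) <= maxt I j}.
Proof.
move=> j jt; rewrite (batch_maxt feas (ltn_ord (tagged t)) jt) andbT.
exact: leq_bigmax_cond.
Qed.

(** A second job would have the same attribute, hence at least the minimal size, and would overfill
    every machine eligible for [j]. *)
Lemma large_job_alone r t j : j \in large_jobs I r -> j \in jobs t ->
  jobs t = [set j].
Proof.
rewrite inE => /andP[/eqP jr j_large] jt.
apply/eqP; rewrite eqEsubset sub1set jt andbT; apply/subsetP => i it.
rewrite inE; apply: contraTT j_large => ij; rewrite -leqNgt.
apply: leq_trans (_ : jsize I j + jsize I i <= _).
  rewrite leq_add2l -minEnat -leEnat; apply: bigmin_le_cond.
  by rewrite (jobs_attr it) -(jobs_attr jt) jr.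
apply: leq_trans (_ : capacity I (tag t) <= _).
  apply: leq_trans (jobs_size t).
  by rewrite (bigD1 j) //= (bigD1 i) ?it //= addnA leq_addr.
by apply: leq_bigmax_cond; apply: jobs_elig.
Qed.

Lemma card_large_jobs r : #|large_jobs I r| <= #|large_batches r|.
Proof.
have [loc locE] := batch_index.
rewrite -(card_in_imset (f := loc) (D := large_jobs I r)).
  apply/subset_leq_card/subsetP => _ /imsetP[j jl ->].
  by rewrite inE; apply/existsP; exists j; rewrite jl locE eqxx.
move=> i j il jl ij; apply/set1P.
by rewrite -(large_job_alone (t := loc i) jl) locE ?ij.
Qed.

Lemma sum_batches :
  \sum_r (#|large_batches r| + #|small_batches r|) <= total_batches sol.
Proof.
rewrite -card_batch_id -sum1_card.
pose ba (t : batch_id) := battr sol (tag t) (tagged t).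
rewrite (partition_big ba xpredT) //=.
apply: leq_sum => r _; rewrite sum1_card.
(* A large job is alone in its batch, so no small job shares it. *)
have /eqP dis : large_batches r :&: small_batches r == set0.
  apply/set0Pn => -[t]; rewrite !inE => /andP[/existsP[j /andP[jl jt]]].
  case/existsP=> i /andP[]; rewrite inE => /andP[/negP iNl _].
  by rewrite (large_job_alone jl jt) inE => /eqP ij; rewrite ij in iNl.
rewrite -cardsUI dis cards0 addn0; apply/subset_leq_card/subsetP => t.
rewrite !inE => tr; suff: ba t == r by [].
case/orP: tr => /existsP[j /andP[]]; rewrite !inE => /andP[].
  by move=> jr _ jt; rewrite /ba -(jobs_attr jt).
by move=> _ jr jt; rewrite /ba -(jobs_attr jt).
Qed.

Lemma small_jobs_bounds r s : gac_order I (small_jobs I r) s ->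
  (bE I r <= #|small_batches r|%:Z)%R /\ bC I s <= #|small_batches r|.
Proof.
move=> s_gac; have [loc locE] := batch_index.
have locB : {in small_jobs I r, forall j, loc j \in small_batches r}.
  by move=> j js; rewrite inE; apply/existsP; exists j; rewrite js locE eqxx.
have jobs_loc j : j \in jobs (loc j) by rewrite locE.
have loc_size t :
    \sum_(j in small_jobs I r | loc j == t) jsize I j <= capacity I (tag t).
  apply: leq_trans (jobs_size t).
  rewrite big_mkcond [leqRHS]big_mkcond leq_sum // => j _.
  by rewrite locE; case: ifP => // /andP[_ ->].
split.
  apply: (@bE_le _ _ _ I r _ _ tag loc locB) => [j _|t _]; last exact: loc_size.
  exact: jobs_elig.
pose point (t : batch_id) := proc_time I sol (tag t) (tagged t).
apply: (@GACb_le _ _ _ I _ _ _ point _ loc s s_gac locB) => [j _|t _].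
  exact: jobs_fit.
exact: leq_trans (loc_size t) (leq_bigmax _).
Qed.

End Batches.

Local Open Scope ring_scope.

Theorem mainTheorem3 (k n a : nat) (I : osp_instance k n a)
    (sol : osp_solution k n a) (feas : feasible I sol)
    (order : 'I_a -> seq 'I_n)
    (order_gac : forall r : 'I_a, gac_order I (small_jobs I r) (order r)) :
  \sum_(r < a) (#|large_jobs I r|%:Z + Num.max (bE I r) (bC I (order r))%:Z)
    <= (total_batches sol)%:Z.
Proof.
have := sum_batches feas; rewrite -lez_nat; apply: le_trans.
rewrite -natz natr_sum; apply: ler_sum => r _.
have [leE leC] := small_jobs_bounds feas (order_gac r).
by rewrite natrD !natz lerD ?ge_max // ?leE ?lez_nat ?card_large_jobs.
Qed.
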